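(* Let $n\ge 1$ and let $d$ be a positive integer with $d\le n$. The number of $d$-cycles in the graph $G(n,312)$ is $$\frac{1}{d}\sum_{e\mid d}\mu\!\left(\frac{d}{e}\right)\binom{2e}{e},$$ where the sum is over the positive divisors $e$ of $d$ and $\mu$ is the number-theoretic Möbius function.
   Context: For a sequence $x=x_1\cdots x_m$ of distinct real numbers, its standardization $\Pi(x)$ is the unique permutation $\pi\in\mathfrak S_m$ with $\pi_i<\pi_j \iff x_i<x_j$ for all $i,j$. A permutation $\pi\in\mathfrak S_m$ avoids $312$ if there are no indices $i<j<k$ with $\pi_j<\pi_k<\pi_i$; $\mathfrak S_m(312)$ denotes the set of such permutations. The graph $G(n,312)$ is the directed multigraph with vertex set $\mathfrak S_n(312)$ having, for each $\sigma=\sigma_1\cdots\sigma_{n+1}\in\mathfrak S_{n+1}(312)$, one directed edge labelled $\sigma$ from $\Pi(\sigma_1\cdots\sigma_n)$ (its tail) to $\Pi(\sigma_2\cdots\sigma_{n+1})$ (its head). A closed walk of length $d$ is a list of $d$ edges $(e_1,\dots,e_d)$ with $\mathrm{head}(e_i)=\mathrm{tail}(e_{i+1})$ for $1\le i\le d-1$ and $\mathrm{head}(e_d)=\mathrm{tail}(e_1)$; different cyclic shifts of a closed walk are considered different closed walks. Two closed walks are equivalent if one is a cyclic shift $(e_i,\dots,e_d,e_1,\dots,e_{i-1})$ of the other. A $d$-cycle is an equivalence class (of closed walks of length $d$) having exactly $d$ elements. *)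

(* Defs.v *)
From HB Require Import structures.
From mathcomp Require Import all_boot all_order all_fingroup all_algebra.
Set Implicit Arguments. Unset Strict Implicit. Unset Printing Implicit Defensive.

Definition word (m : nat) (p : {perm 'I_m}) : seq nat := [seq (p i : nat) | i <- enum 'I_m].

Definition std (s : seq nat) : seq nat := [seq count (fun y => y < x) s | x <- s].

Definition avoids312 (m : nat) (p : {perm 'I_m}) : bool :=
  ~~ [exists i : 'I_m, exists j : 'I_m, exists k : 'I_m,
        [&& i < j, j < k, p j < p k & p k < p i]].

(* Edge labelled sigma in G(n,312): tail = Pi(sigma_1..sigma_n),
   head = Pi(sigma_2..sigma_{n+1}) (as one-line words of S_n). *)
Definition etail (n : nat) (s : {perm 'I_n.+1}) : seq nat := std (take n (word s)).
Definition ehead (n : nat) (s : {perm 'I_n.+1}) : seq nat := std (drop 1 (word s)).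

Definition closed_walk (n d : nat) (w : d.-tuple {perm 'I_n.+1}) : bool :=
  all (@avoids312 n.+1) w &&
  [forall i : 'I_d,
     ehead (tnth w i) == etail (nth 1%g w (i.+1 %% d))].

Definition walk_class (n d : nat) (w : d.-tuple {perm 'I_n.+1})
  : {set d.-tuple {perm 'I_n.+1}} :=
  [set [tuple of rot i w] | i : 'I_d].

Definition d_cycles (n d : nat) : {set {set d.-tuple {perm 'I_n.+1}}} :=
  [set walk_class w | w in [pred w | closed_walk w && (#|walk_class w| == d)]].

(* Number-theoretic Moebius function (for n >= 1). *)
Definition moebius (n : nat) : int :=
  if all (fun p => logn p n == 1) (primes n) then ((-1) ^+ size (primes n))%R else 0%R.

(* Main.v *)
Require Import Defs.
From mathcomp Require Import all_boot all_order all_fingroup all_algebra.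
From mathcomp Require Import zify.
Import GRing.Theory.

(** A closed walk of length d, read backwards, is a d-periodic sequence of
windows.  312-avoidance says that the entries exceeding a given entry k inside
the window preceding it form a block adjacent to it, of length u k <= n; the
sequence u determines the walk, and the only condition on it is that the
blocks with u k < n are nested.  When d <= n periodicity forces u k < d or
u k = n, so n plays the role of infinity.

Nested blocks form a plane forest: u k is the number of descendants of k, and
we let c k be the number of its children.  Each position has at most one
parent, so the sum of c over a period is at most d.  Conversely u k is the least
t with c k + ... + c (k + t) <= t (and n if no t < d works), and every c : N^d of
sum at most d occurs.  There are 'C(2d, d) such c, hence 'C(2d, d) closed walks.
Sorting closed walks by the size e | d of their rotation class, Moebius
inversion counts the primitive ones, and each d-cycle consists of d of them. *)

Set Implicit Arguments. Unset Strict Implicit. Unset Printing Implicit Defensive.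

(** * Moebius inversion *)

Lemma big_divisors_ord (R : Type) (idx : R) (op : Monoid.com_law idx) m N (F : nat -> R) :
  0 < m < N ->
  \big[op/idx]_(e < N | e %| m) F e = \big[op/idx]_(e <- divisors m) F e.
Proof.
move=> /andP[m_gt0 mN]; rewrite -(big_mkord (fun e => e %| m)) -big_filter.
apply/perm_big/uniq_perm => [||e]; rewrite ?filter_uniq ?iota_uniq ?divisors_uniq //.
rewrite mem_filter mem_index_iota -dvdn_divisors //=.
by have [/(dvdn_leq m_gt0)|//] := boolP (e %| m); lia.
Qed.

Lemma perm_divisors_dvd m e : 0 < m -> e %| m ->
  perm_eq [seq f <- divisors m | f %| e] (divisors e).
Proof.
move=> m_gt0 e_dvd_m; have e_gt0 := dvdn_gt0 m_gt0 e_dvd_m.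
apply: uniq_perm => [||f]; rewrite ?filter_uniq ?divisors_uniq //.
rewrite mem_filter -!dvdn_divisors //.
by have [f_dvd_e|//] := boolP (f %| e); rewrite (dvdn_trans f_dvd_e).
Qed.

Lemma perm_divisors_multiples p m : 0 < m -> p %| m ->
  perm_eq [seq e <- divisors m | p %| e] [seq p * f | f <- divisors (m %/ p)].
Proof.
move=> m_gt0 p_dvd_m; have p_gt0 := dvdn_gt0 m_gt0 p_dvd_m.
have q_gt0 : 0 < m %/ p by rewrite divn_gt0 // dvdn_leq.
apply: uniq_perm => [||e].
- by rewrite filter_uniq ?divisors_uniq.
- by rewrite map_inj_uniq ?divisors_uniq // => x y /eqP; rewrite eqn_pmul2l // => /eqP.
rewrite mem_filter -dvdn_divisors //; apply/andP/mapP => [[pe e_dvd_m]|[f]].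
  by exists (e %/ p); rewrite -?dvdn_divisors ?dvdn_divRL ?divnK // mulnC divnK.
by rewrite -dvdn_divisors // => fm ->; rewrite dvdn_mulr // mulnC -dvdn_divRL.
Qed.

Lemma perm_divisors_divn m : 0 < m ->
  perm_eq [seq m %/ e | e <- divisors m] (divisors m).
Proof.
move=> m_gt0; have divK e : e %| m -> m %/ (m %/ e) = e.
  by move=> e_dvd_m; rewrite divnA // mulKn.
apply: uniq_perm => [||e]; rewrite ?divisors_uniq //.
  rewrite map_inj_in_uniq ?divisors_uniq // => x y.
  by rewrite -!dvdn_divisors // => xm ym /(congr1 (divn m)); rewrite !divK.
rewrite -dvdn_divisors //; apply/mapP/idP => [[f]|e_dvd_m].
  by rewrite -dvdn_divisors // => fm ->; apply: dvdn_div.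
by exists (m %/ e); rewrite -?dvdn_divisors ?dvdn_div ?divK.
Qed.

Lemma perm_divisors_ndvd_prime p m : prime p -> 0 < m -> p %| m ->
  perm_eq [seq e <- divisors m | ~~ (p %| e)] [seq e <- divisors (m %/ p) | ~~ (p %| e)].
Proof.
move=> p_prime m_gt0 p_dvd_m.
have q_gt0 : 0 < m %/ p by rewrite divn_gt0 ?prime_gt0 // dvdn_leq.
apply: uniq_perm => [||e]; rewrite ?filter_uniq ?divisors_uniq //.
rewrite !mem_filter -!dvdn_divisors //; case pe: (p %| e) => //=.
by rewrite -{1}(divnK p_dvd_m) Gauss_dvdl // coprime_sym prime_coprime ?pe.
Qed.

Section Moebius.
Local Open Scope ring_scope.

Lemma moebius_primeM p m : prime p -> (0 < m)%N ->
  moebius (p * m) = if (p %| m)%N then 0 else - moebius m.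
Proof.
move=> p_prime m_gt0; have p_gt0 := prime_gt0 p_prime.
have [p_dvd_m|p_ndvd_m] := boolP (p %| m)%N.
  rewrite /moebius ifF //; apply/negP => /allP/(_ p).
  rewrite primesM // primes_prime // !inE eqxx /= => /(_ isT).
  rewrite lognM // logn_prime // eqxx eqn_leq andbC /=.
  by have := logn_gt0 p m; rewrite mem_primes p_prime m_gt0 p_dvd_m /=; lia.
have permP : perm_eq (primes (p * m)) (p :: primes m).
  apply: uniq_perm; rewrite /= ?primes_uniq ?mem_primes ?(negPf p_ndvd_m) ?andbF //.
  by move=> q; rewrite primesM // primes_prime // !inE.
rewrite /moebius (perm_all _ permP) (perm_size permP) /=.
rewrite lognM // logn_prime // eqxx /= lognE p_prime m_gt0 (negPf p_ndvd_m) /=.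
have -> : all (fun q => logn q (p * m) == 1)%N (primes m)
        = all (fun q => logn q m == 1)%N (primes m).
  apply: eq_in_all => q; rewrite mem_primes => /and3P[q_prime _ q_dvd_m].
  rewrite lognM // logn_prime //; have [eq_qp|//] := eqVneq q p.
  by rewrite -eq_qp q_dvd_m in p_ndvd_m.
by case: ifP; rewrite ?oppr0 // exprS mulN1r.
Qed.

(* For a prime p dividing m, the divisors e and p e with p not dividing e cancel. *)
Lemma sum_moebius m : (0 < m)%N -> \sum_(e <- divisors m) moebius e = (m == 1)%N%:R.
Proof.
move=> m_gt0; have [->|m1] := eqVneq m 1%N; first by rewrite big_seq1.
have p_prime : prime (pdiv m) by apply: pdiv_prime; lia.
set p := pdiv m in p_prime; have p_dvd_m : (p %| m)%N := pdiv_dvd m.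
have q_gt0 : (0 < m %/ p)%N by rewrite divn_gt0 ?prime_gt0 // dvdn_leq.
rewrite (bigID (fun e => p %| e)%N) /=.
have -> : \sum_(e <- divisors m | (p %| e)%N) moebius e
        = - \sum_(e <- divisors (m %/ p) | ~~ (p %| e)%N) moebius e.
  rewrite -big_filter (perm_big _ (perm_divisors_multiples m_gt0 p_dvd_m)) big_map.
  rewrite [X in - X]big_mkcond -sumrN /=; apply: eq_big_seq => e.
  rewrite -dvdn_divisors // => /(dvdn_gt0 q_gt0) e_gt0.
  by rewrite moebius_primeM //; case: ifP; rewrite ?oppr0.
rewrite -[X in _ + X]big_filter.
by rewrite (perm_big _ (perm_divisors_ndvd_prime p_prime m_gt0 p_dvd_m)) big_filter addNr.
Qed.

Lemma moebius_inversion (R : pzRingType) (A P : nat -> R) d : (0 < d)%N ->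
  (forall e, (e %| d)%N -> A e = \sum_(f <- divisors e) P f) ->
  \sum_(e <- divisors d) (moebius (d %/ e))%:~R * A e = P d.
Proof.
move=> d_gt0 A_sum.
have divisorP e : (e \in divisors d) = (e %| d)%N by rewrite dvdn_divisors.
have cofactor_sum f : (f %| d)%N ->
    \sum_(e <- divisors d | (f %| e)%N) (moebius (d %/ e))%:~R = (f == d)%:R :> R.
  move=> f_dvd_d; have f_gt0 := dvdn_gt0 d_gt0 f_dvd_d.
  have q_gt0 : (0 < d %/ f)%N by rewrite divn_gt0 // dvdn_leq.
  rewrite -big_filter (perm_big _ (perm_divisors_multiples d_gt0 f_dvd_d)) big_map.
  under eq_bigr do rewrite divnMA.
  rewrite -(big_map (divn (d %/ f)) predT (fun g => (moebius g)%:~R)).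
  rewrite (perm_big _ (perm_divisors_divn q_gt0)) /= -rmorph_sum sum_moebius //= rmorph_nat.
  congr (nat_of_bool _)%:R; apply/eqP/eqP => [df|->]; last by rewrite divnn d_gt0.
  by rewrite -(divnK f_dvd_d) df mul1n.
have -> : \sum_(e <- divisors d) (moebius (d %/ e))%:~R * A e
        = \sum_(e <- divisors d) \sum_(f <- divisors d | (f %| e)%N)
            (moebius (d %/ e))%:~R * P f.
  apply: eq_big_seq => e; rewrite divisorP => e_dvd_d; rewrite A_sum // mulr_sumr.
  by rewrite -(perm_big _ (perm_divisors_dvd d_gt0 e_dvd_d)) big_filter.
rewrite (exchange_big_dep predT) //=; under eq_bigr do rewrite -mulr_suml.
rewrite (bigD1_seq d) ?divisorP ?divisors_uniq //= cofactor_sum // eqxx mul1r.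
rewrite big_seq_cond big1 ?addr0 // => f; rewrite divisorP => /andP[f_dvd_d /negPf fNd].
by rewrite cofactor_sum // fNd mul0r.
Qed.

End Moebius.

(** * Periodic sequences *)

Definition periodic (T : Type) (d : nat) (f : nat -> T) : Prop :=
  forall k, f (k + d) = f k.

Lemma periodic_dvd (T : Type) (f : nat -> T) d e : periodic d f -> d %| e -> periodic e f.
Proof.
move=> f_periodic /dvdnP[q ->]; elim: q => [|q IHq] k; first by rewrite addn0.
by rewrite mulSn addnA IHq.
Qed.

Lemma periodic_modn (T : Type) (f : nat -> T) d k : periodic d f -> f (k %% d) = f k.
Proof.
move=> f_periodic; rewrite [in RHS](divn_eq k d) addnC.
by rewrite (periodic_dvd f_periodic) ?dvdn_mull.
Qed.

Definition cyclic_nth (T : Type) (x0 : T) (s : seq T) (k : nat) : T :=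
  nth x0 s (k %% size s).

Section CyclicNth.
Variables (T : Type) (x0 : T).
Implicit Types s : seq T.

Lemma cyclic_nth_small s k : k < size s -> cyclic_nth x0 s k = nth x0 s k.
Proof. by move=> ks; rewrite /cyclic_nth modn_small. Qed.

Lemma cyclic_nth_rot1 s k : cyclic_nth x0 (rot 1 s) k = cyclic_nth x0 s k.+1.
Proof.
case: s => [|x s]; first by rewrite /cyclic_nth !nth_nil.
rewrite rot1_cons /cyclic_nth size_rcons /= -(addn1 k) -(modnDml k) nth_rcons.
have: k %% (size s).+1 <= size s by rewrite -ltnS ltn_pmod.
rewrite leq_eqVlt => /predU1P[->|ks]; first by rewrite ltnn eqxx addn1 modnn.
by rewrite ks addn1 (@modn_small _.+1).
Qed.

Lemma cycle_nthP (e : rel T) s : 0 < size s ->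
  reflect (forall k, e (cyclic_nth x0 s k) (cyclic_nth x0 s k.+1)) (path.cycle e s).
Proof.
move=> s_gt0; have sE k : k < size s -> cyclic_nth x0 s k.+1 = nth x0 (rot 1 s) k.
  by move=> ks; rewrite -cyclic_nth_rot1 cyclic_nth_small ?size_rot.
case: s s_gt0 sE => [//|x s] _ sE.
rewrite -[path.cycle _ _]/(path e x (rcons s x)) -rot1_cons.
have headE k : k < (size s).+1 -> nth x0 (x :: rot 1 (x :: s)) k = nth x0 (x :: s) k.
  by move=> ks; rewrite rot1_cons -rcons_cons nth_rcons ks.
apply: (iffP (pathP x0)) => [s_step k|s_step i]; last rewrite size_rot => ix.
  have ks : k %% (size s).+1 < (size s).+1 by rewrite ltn_pmod.
  have := s_step (k %% (size s).+1); rewrite size_rot headE // -sE // => /(_ ks).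
  by rewrite /cyclic_nth /= -[(k %% _).+1]addn1 modnDml addn1.
by rewrite headE // -sE // -cyclic_nth_small.
Qed.

End CyclicNth.

Lemma mem_cyclic_nth (T : eqType) (x0 : T) (s : seq T) k :
  0 < size s -> cyclic_nth x0 s k \in s.
Proof. by move=> s_gt0; rewrite mem_nth ?ltn_pmod. Qed.

Lemma cyclic_nth_mktuple (T : Type) (x0 : T) (f : nat -> T) d : 0 < d -> periodic d f ->
  cyclic_nth x0 [tuple f i | i < d] =1 f.
Proof.
move=> d_gt0 f_periodic k; rewrite /cyclic_nth size_tuple.
by rewrite (nth_mktuple _ _ (Ordinal (ltn_pmod k d_gt0))) periodic_modn.
Qed.

Lemma periodic_cyclic_nth_tuple (T : Type) (x0 : T) d (w : d.-tuple T) :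
  periodic d (cyclic_nth x0 w).
Proof. by move=> k; rewrite /cyclic_nth size_tuple modnDr. Qed.

Lemma cyclic_nth_tuple_inj (T : Type) (x0 : T) d (w v : d.-tuple T) :
  cyclic_nth x0 w =1 cyclic_nth x0 v -> w = v.
Proof.
move=> wv; apply/val_inj/(@eq_from_nth _ x0) => [|i]; rewrite ?size_tuple // => id.
by rewrite -!cyclic_nth_small ?size_tuple.
Qed.

(** * Primitive cycles of a digraph *)

Lemma iter_fix_dvdn_order (T : finType) (f : T -> T) x n : injective f ->
  (iter n f x == x) = (fingraph.order f x %| n).
Proof.
move=> f_inj; set o := fingraph.order f x.
have iter_mul q : iter (q * o) f x = x.
  by elim: q => [//|q IHq]; rewrite mulSn iterD IHq iter_order.
rewrite [in LHS](divn_eq n o) addnC iterD iter_mul /dvdn.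
have := findex_iter (ltn_pmod n (fingraph.order_gt0 f x)); rewrite -/o => nE.
by rewrite -[in RHS]nE eq_sym findex_eq0.
Qed.

Section RotationClasses.
Variables (T : finType) (d : nat).
Hypothesis d_gt0 : 0 < d.
Implicit Types w v : d.-tuple T.

Definition rot1_tuple w : d.-tuple T := [tuple of rot 1 w].

Definition rot_class w : {set d.-tuple T} := [set [tuple of rot i w] | i : 'I_d].

Lemma rot1_tuple_inj : injective rot1_tuple.
Proof. by move=> w v /(congr1 val)/rot_inj/val_inj. Qed.

Lemma iter_rot1_tuple i w : i <= d -> iter i rot1_tuple w = [tuple of rot i w].
Proof.
move=> id; apply: val_inj; elim: i id => [|i IHi] id /=; first by rewrite rot0.
by rewrite IHi 1?ltnW // -rotS // size_tuple.
Qed.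

Lemma dvdn_order_rot1_tuple w : fingraph.order rot1_tuple w %| d.
Proof.
rewrite -iter_fix_dvdn_order; last exact: rot1_tuple_inj.
rewrite iter_rot1_tuple //; apply/eqP/val_inj.
by rewrite /= -[X in rot X](size_tuple w) rot_size.
Qed.

Lemma mem_rot_class w v : (v \in rot_class w) = fconnect rot1_tuple w v.
Proof.
apply/imsetP/idP => [[i _ ->]|wv].
  by rewrite -iter_rot1_tuple ?(ltnW (ltn_ord i)) // fconnect_iter.
have id : findex rot1_tuple w v < d.
  exact: leq_trans (findex_max wv) (dvdn_leq d_gt0 (dvdn_order_rot1_tuple w)).
by exists (Ordinal id) => //=; rewrite -iter_rot1_tuple ?iter_findex // ltnW.
Qed.

Lemma card_rot_class w : #|rot_class w| = fingraph.order rot1_tuple w.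
Proof. by apply: eq_card => v; rewrite mem_rot_class. Qed.

Lemma eq_rot_class w v : v \in rot_class w -> rot_class v = rot_class w.
Proof.
rewrite mem_rot_class => wv; apply/setP => u; rewrite !mem_rot_class.
by rewrite (same_connect (fconnect_sym rot1_tuple_inj) wv).
Qed.

Lemma card_rot_classes (A : {set d.-tuple T}) m :
  {in A, forall w, rot_class w \subset A} -> {in A, forall w, #|rot_class w| = m} ->
  #|[set rot_class w | w in A]| * m = #|A|.
Proof.
move=> A_closed A_card; rewrite -(@card_uniform_partition _ m _ A) => [//||].
  by move=> _ /imsetP[w wA ->]; apply: A_card.
have -> : [set rot_class w | w in A] = equivalence_partition (fconnect rot1_tuple) A.
  apply: eq_in_imset => w wA; apply/setP => v; rewrite inE mem_rot_class andbC.
  have [wv|//] := boolP (fconnect _ w v).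
  by rewrite (subsetP (A_closed w wA)) // mem_rot_class.
apply: equivalence_partitionP => w v u _ _ _; split=> [|wv]; first exact: connect0.
by rewrite (same_connect (fconnect_sym rot1_tuple_inj) wv).
Qed.

Lemma periodic_dvdn_rot_class (x0 : T) w e :
  periodic e (cyclic_nth x0 w) <-> #|rot_class w| %| e.
Proof.
have nthE k : cyclic_nth x0 (iter e rot1_tuple w) k = cyclic_nth x0 w (k + e).
  elim: e k => [|e IHe] k; first by rewrite addn0.
  by rewrite addnS -addSn -IHe iterS cyclic_nth_rot1.
rewrite card_rot_class -iter_fix_dvdn_order; last exact: rot1_tuple_inj.
split=> [we|/eqP we k]; last by rewrite -nthE we.
by apply/eqP/(@cyclic_nth_tuple_inj _ x0) => k; rewrite nthE we.
Qed.

End RotationClasses.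

Lemma eq_card_rot_class (T : finType) (x0 : T) d e (w : d.-tuple T) (v : e.-tuple T) :
  0 < d -> 0 < e -> cyclic_nth x0 w =1 cyclic_nth x0 v -> #|rot_class w| = #|rot_class v|.
Proof.
move=> d_gt0 e_gt0 wv; apply/eqP; rewrite eqn_dvd; apply/andP; split.
  apply/(periodic_dvdn_rot_class d_gt0 x0) => k.
  by rewrite !wv; move: k; apply/(periodic_dvdn_rot_class e_gt0).
apply/(periodic_dvdn_rot_class e_gt0 x0) => k.
by rewrite -!wv; move: k; apply/(periodic_dvdn_rot_class d_gt0).
Qed.

Section PrimitiveCycles.
Variables (T : finType) (x0 : T) (e : rel T).

Definition cycles d : {set d.-tuple T} := [set w : d.-tuple T | path.cycle e w].

Definition primitive_cycles d : {set d.-tuple T} :=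
  [set w in cycles d | #|rot_class w| == d].

Lemma eq_mem_cycles d m (w : d.-tuple T) (v : m.-tuple T) : 0 < d -> 0 < m ->
  cyclic_nth x0 w =1 cyclic_nth x0 v -> (w \in cycles d) = (v \in cycles m).
Proof.
move=> d_gt0 m_gt0 wv; rewrite !inE.
by apply/(cycle_nthP x0)/(cycle_nthP x0); rewrite ?size_tuple // => step k;
  have := step k; rewrite !wv.
Qed.

Lemma card_cycles_period d m : 0 < d -> m %| d ->
  #|[set w in cycles d | #|rot_class w| == m]| = #|primitive_cycles m|.
Proof.
move=> d_gt0 m_dvd_d; have m_gt0 := dvdn_gt0 d_gt0 m_dvd_d.
pose unroll (v : m.-tuple T) : d.-tuple T := [tuple cyclic_nth x0 v i | i < d].
have unrollE v : cyclic_nth x0 (unroll v) =1 cyclic_nth x0 v.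
  apply: (@cyclic_nth_mktuple _ x0 (cyclic_nth x0 v)) => //.
  by apply: periodic_dvd m_dvd_d; apply: periodic_cyclic_nth_tuple.
have unroll_inj : injective unroll.
  by move=> v v' vv'; apply: (@cyclic_nth_tuple_inj _ x0) => k; rewrite -!unrollE vv'.
have unroll_mem v : (unroll v \in [set w in cycles d | #|rot_class w| == m])
                  = (v \in primitive_cycles m).
  by rewrite [LHS]in_set [RHS]in_set (eq_mem_cycles d_gt0 m_gt0 (unrollE v))
    (eq_card_rot_class d_gt0 m_gt0 (unrollE v)).
rewrite -(card_imset _ unroll_inj); apply: eq_card => w.
apply/idP/imsetP => [wm|[v vm ->]].
  pose v : m.-tuple T := [tuple cyclic_nth x0 w i | i < m].
  suff wv : w = unroll v by exists v => //; rewrite -unroll_mem -wv.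
  apply: (@cyclic_nth_tuple_inj _ x0) => k; rewrite unrollE; symmetry.
  apply: (@cyclic_nth_mktuple _ x0 (cyclic_nth x0 w)) => //.
  apply/(periodic_dvdn_rot_class d_gt0).
  by move: wm; rewrite inE => /andP[_ /eqP ->].
by rewrite unroll_mem.
Qed.

Lemma card_cycles_primitive d : 0 < d ->
  #|cycles d| = \sum_(m <- divisors d) #|primitive_cycles m|.
Proof.
move=> d_gt0; have class_dvd (w : d.-tuple T) : #|rot_class w| %| d.
  by rewrite card_rot_class // dvdn_order_rot1_tuple.
rewrite -(@big_divisors_ord _ _ _ d d.+1) ?d_gt0 //= -sum1_card.
rewrite (partition_big (fun w => inord #|rot_class w| : 'I_d.+1) (fun m => m %| d)) /=.
  apply: eq_bigr => m m_dvd_d; rewrite -(card_cycles_period d_gt0 m_dvd_d) -sum1_card.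
  apply: eq_bigl => w; rewrite !in_set -val_eqE /= inordK // ltnS.
  exact: dvdn_leq (class_dvd w).
by move=> w _; rewrite inordK ?class_dvd // ltnS dvdn_leq.
Qed.

Lemma card_primitive_rot_classes d : 0 < d ->
  #|[set rot_class w | w in primitive_cycles d]| * d = #|primitive_cycles d|.
Proof.
move=> d_gt0; apply: card_rot_classes => // w; rewrite inE => /andP[wd /eqP wc] //.
apply/subsetP => v vw; rewrite inE (eq_rot_class d_gt0 vw) wc eqxx andbT.
have /imsetP[i _ ->] := vw.
by move: wd; rewrite !inE rot_cycle.
Qed.

Local Open Scope ring_scope.

Lemma card_primitive_rot_classes_moebius (F : numFieldType) d : (0 < d)%N ->
  #|[set rot_class w | w in primitive_cycles d]|%:R =
    d%:R^-1 * \sum_(m <- divisors d) (moebius (d %/ m))%:~R * #|cycles m|%:R :> F.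
Proof.
move=> d_gt0; have dF : d%:R != 0 :> F by rewrite Num.Theory.pnatr_eq0 -lt0n.
apply: (mulIf dF); rewrite -natrM card_primitive_rot_classes // mulrAC mulVf // mul1r.
rewrite (moebius_inversion (P := fun m => #|primitive_cycles m|%:R)) // => m m_dvd_d.
by rewrite card_cycles_primitive ?natr_sum // (dvdn_gt0 d_gt0).
Qed.

End PrimitiveCycles.

Lemma card_cycles_rev (T : finType) (e : rel T) d :
  #|cycles (fun x y => e y x) d| = #|cycles e d|.
Proof.
have rev_inj : injective (fun w : d.-tuple T => [tuple of rev w]).
  by move=> w v /(congr1 val)/(can_inj revK)/val_inj.
rewrite -(on_card_preimset (f := fun w : d.-tuple T => [tuple of rev w])).
  by apply: eq_card => w; rewrite !inE rev_cycle.
by apply: onW_bij; apply: injF_bij.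
Qed.

(** * Periodic plane forests *)

Lemma sum_le1_leq a b (F : nat -> nat) :
  (forall i, F i <= 1) -> \sum_(a <= i < b) F i <= b - a.
Proof. by move=> F1; rewrite -[b - a]muln1 -sum_nat_const_nat; apply: leq_sum. Qed.

Lemma sum_gt0_geq a b (F : nat -> nat) :
  (forall i, a <= i < b -> 0 < F i) -> b - a <= \sum_(a <= i < b) F i.
Proof.
move=> F0; rewrite -[b - a]muln1 -sum_nat_const_nat big_nat [leqRHS]big_nat.
exact: leq_sum.
Qed.

Lemma sum_nat_split3 a b m (F : nat -> nat) : a <= b <= m ->
  \sum_(0 <= i < m) F i
    = \sum_(0 <= i < a) F i + \sum_(a <= i < b) F i + \sum_(b <= i < m) F i.
Proof.
move=> /andP[ab bm]; rewrite (big_cat_nat (leq0n b) bm) /=.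
by rewrite (big_cat_nat (leq0n a) ab).
Qed.

Lemma sum_nat_support a b m (F : nat -> nat) : a <= b <= m ->
  (forall i, ~~ (a <= i < b) -> F i = 0) -> \sum_(0 <= i < m) F i = \sum_(a <= i < b) F i.
Proof.
move=> abm F0; rewrite (sum_nat_split3 _ abm) big_nat big1 => [|i ia].
  by rewrite add0n [X in _ + X]big_nat [X in _ + X]big1 ?addn0 // => i bi; apply: F0; lia.
by apply: F0; lia.
Qed.

Lemma sum_nat_mul_period d (c : nat -> nat) k q : periodic d c ->
  \sum_(k <= i < k + q * d) c i = q * \sum_(0 <= i < d) c i.
Proof.
move=> c_periodic; have start m : \sum_(m <= i < m + d) c i = \sum_(0 <= i < d) c i.
  elim: m => [//|m <-]; apply/eqP; rewrite -(eqn_add2l (c m)) addSn -big_ltn; last lia.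
  by rewrite big_nat_recr ?leq_addr //= addnC c_periodic.
elim: q k => [|q IHq] k; first by rewrite addn0 big_geq.
by rewrite (big_cat_nat (n := k + d)) ?start ?leq_add2l ?mulSn ?leq_addr //= addnA IHq.
Qed.

(* [c] lists the numbers of children of a plane forest in preorder; the value [n]
   stands for infinity. *)
Definition descendants (n d : nat) (c : nat -> nat) (k : nat) : nat :=
  let t := find (fun t => \sum_(k <= i < k + t.+1) c i <= t) (iota 0 d) in
  if t < d then t else n.

Variant descendants_spec (n d : nat) (c : nat -> nat) (k : nat) : nat -> Prop :=
  | FiniteDescendants t of t < d & \sum_(k <= i < k + t.+1) c i <= t
      & (forall s, s < t -> s < \sum_(k <= i < k + s.+1) c i) :
    descendants_spec n d c k t
  | InfiniteDescendants of (forall s, s < d -> s < \sum_(k <= i < k + s.+1) c i) :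
    descendants_spec n d c k n.

Definition nested (n : nat) (u : nat -> nat) : Prop :=
  forall k j, u k < n -> k < j <= k + u k -> j + u j <= k + u k.

Section Descendants.
Variables n d : nat.
Hypothesis d_le_n : d <= n.
Implicit Types c : nat -> nat.
Local Notation desc := (descendants n d).

Lemma descendantsP c k : descendants_spec n d c k (desc c k).
Proof.
rewrite /descendants; set closes := fun t => _ <= t; set t := find _ _.
have before s : s < t -> s < d -> s < \sum_(k <= i < k + s.+1) c i.
  move=> st sd; have := before_find 0 st.
  by rewrite nth_iota // add0n /closes ltnNge => ->.
have [td|dt] := ltnP t d.
  apply: FiniteDescendants => // [|s st]; last exact: before st (ltn_trans st td).
  by have := td; rewrite -[d](size_iota 0) -has_find => /(nth_find 0); rewrite nth_iota.
by apply: InfiniteDescendants => s sd; apply: before (leq_trans sd dt) sd.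
Qed.

Lemma descendants_unique c k v :
  (forall s, s < d -> s < v -> s < \sum_(k <= i < k + s.+1) c i) ->
  v < d /\ \sum_(k <= i < k + v.+1) c i <= v \/ v = n -> desc c k = v.
Proof.
move=> before last; case: descendantsP => [t td closes_t before_t|before_d].
  have [tv|vt|//] := ltngtP t v; first by have := before t td tv; lia.
  by case: last => [[_]|]; have := before_t v vt; lia.
by case: last => [[vd]|//]; have := before_d v vd; lia.
Qed.

Lemma eq_descendants c c' k k' : (forall i, c (k + i) = c' (k' + i)) ->
  desc c k = desc c' k'.
Proof.
move=> cc'; rewrite /descendants.
suff sumE t : \sum_(k <= i < k + t.+1) c i = \sum_(k' <= i < k' + t.+1) c' i.
  by under eq_find do rewrite sumE.
rewrite -{1}[k]add0n -[in RHS](add0n k') !big_addn !addKn.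
by apply: eq_bigr => i _; rewrite addnC cc' addnC.
Qed.

Lemma periodic_descendants c : periodic d c -> periodic d (desc c).
Proof. by move=> c_periodic k; apply: eq_descendants => i; rewrite addnAC c_periodic. Qed.

Lemma descendants_le c k : desc c k <= n.
Proof. case: descendantsP => [t td _ _|//]; lia. Qed.

Lemma descendants_fin c k : desc c k < n -> desc c k < d.
Proof. case: descendantsP => //; lia. Qed.

Lemma descendants_min c k t :
  t < d -> \sum_(k <= i < k + t.+1) c i <= t -> desc c k <= t.
Proof.
move=> td closes_t; case: descendantsP => [v vd _ before|before].
  by rewrite leqNgt; apply/negP => /before; lia.
by have := before t td; lia.
Qed.

Lemma leq_sum_descendants c k s :
  s <= d -> s <= desc c k -> s <= \sum_(k <= i < k + s) c i.
Proof.
case: s => [//|s] sd; case: descendantsP => [t _ _ before|before _]; first exact: before.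
exact: before.
Qed.

Lemma sum_descendants c k : desc c k < n ->
  \sum_(k <= i < k + (desc c k).+1) c i = desc c k.
Proof.
move=> k_finite; have desc_lt_d := descendants_fin k_finite.
apply/eqP; rewrite eqn_leq; apply/andP; split.
  by move: k_finite; case: descendantsP => [//|_]; rewrite ltnn.
apply: leq_trans (leq_sum_descendants (ltnW desc_lt_d) (leqnn _)) _.
by rewrite addnS big_nat_recr ?leq_addr.
Qed.

Lemma nested_descendants c : nested n (desc c).
Proof.
move=> k j k_finite kj.
have desc_lt_d : desc c k < d := descendants_fin k_finite.
have := sum_descendants k_finite; rewrite (big_cat_nat (n := j)) /=; try lia.
have jk : j - k <= desc c k by lia.
have := leq_sum_descendants (leq_trans jk (ltnW desc_lt_d)) jk; rewrite subnKC; last lia.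
have := @descendants_min c j (k + desc c k - j) ltac:(lia).
have -> : j + (k + desc c k - j).+1 = k + (desc c k).+1 by lia.
lia.
Qed.

Lemma descendants_inj_fin c c' k : desc c =1 desc c' ->
  desc c k < n -> c k = c' k.
Proof.
move=> eq_desc; have [m] := ubnP (desc c k); elim: m k => // m IHm k desc_lt_m k_finite.
have := sum_descendants k_finite.
have := @sum_descendants c' k; rewrite -!eq_desc => /(_ k_finite).
rewrite addnS !(big_ltn (m := k)); try lia.
suff -> : \sum_(k.+1 <= i < (k + desc c k).+1) c i
        = \sum_(k.+1 <= i < (k + desc c k).+1) c' i by lia.
apply: eq_big_nat => i ki.
have := @nested_descendants c k i k_finite; rewrite -ltnS => nest.
by apply: IHm; lia.
Qed.

Lemma sum_infinite_descendants c k t :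
  periodic d c -> \sum_(0 <= i < d) c i <= d -> t <= d ->
  d <= desc c k -> d <= desc c (k + t) -> \sum_(k <= i < k + t) c i = t.
Proof.
move=> c_periodic c_sum td dk dkt.
have := sum_nat_mul_period k 1 c_periodic; rewrite !mul1n.
rewrite (big_cat_nat (n := k + t)) ?leq_add2l ?leq_addr //=.
have := @leq_sum_descendants c k t td ltac:(lia).
have := @leq_sum_descendants c (k + t) (d - t) ltac:(lia) ltac:(lia).
have -> : k + t + (d - t) = k + d by lia.
lia.
Qed.

(* Between two consecutive positions with infinitely many descendants, [c] is
   determined by [descendants_inj_fin] and has a prescribed sum. *)
Lemma descendants_inj c c' : 0 < d -> periodic d c -> periodic d c' ->
  \sum_(0 <= i < d) c i <= d -> \sum_(0 <= i < d) c' i <= d ->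
  desc c =1 desc c' -> c =1 c'.
Proof.
move=> d_gt0 c_periodic c'_periodic c_sum c'_sum eq_desc k.
have [|k_infinite] := ltnP (desc c k) n; first exact: descendants_inj_fin.
pose next_infinite t := (0 < t) && (n <= desc c (k + t)).
have d_next : next_infinite d by rewrite /next_infinite d_gt0 periodic_descendants.
have [t /andP[t_gt0 ukt] t_min] := ex_minnP (ex_intro next_infinite d d_next).
have td : t <= d := t_min d d_next.
have := @sum_infinite_descendants c k t c_periodic c_sum td ltac:(lia) ltac:(lia).
have := @sum_infinite_descendants c' k t c'_periodic c'_sum td; rewrite -!eq_desc.
move=> /(_ ltac:(lia) ltac:(lia)); rewrite !(big_ltn (m := k)); try lia.
suff -> : \sum_(k.+1 <= i < k + t) c i = \sum_(k.+1 <= i < k + t) c' i by lia.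
apply: eq_big_nat => i ki; apply: descendants_inj_fin => //.
rewrite ltnNge; apply/negP => ui; have := t_min (i - k).
by rewrite /next_infinite subnKC; lia.
Qed.

End Descendants.

(* The interval [k, k + u k] is the innermost one whose left end precedes [j]. *)
Definition parent (u : nat -> nat) (k j : nat) : bool :=
  [&& k < j, j <= k + u k & all (fun i => i + u i < j) (index_iota k.+1 j)].

Definition children (d : nat) (u : nat -> nat) (k : nat) : nat :=
  \sum_(k.+1 <= j < k + d.+1) parent u k j.

Section Children.
Variable u : nat -> nat.

Lemma parentP k j :
  reflect [/\ k < j, j <= k + u k & forall i, k < i < j -> i + u i < j] (parent u k j).
Proof.
apply: (iffP and3P) => -[kj ju]; first move=> /allP outside; last move=> outside.
  by split=> // i kij; apply: outside; rewrite mem_index_iota.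
by split=> //; apply/allP => i; rewrite mem_index_iota => /outside.
Qed.

Lemma parent_inj k k' j : parent u k j -> parent u k' j -> k = k'.
Proof.
move=> /parentP[kj ju outside] /parentP[kj' ju' outside'].
by have := outside k'; have := outside' k; lia.
Qed.

Lemma exists_parent k j : k < j <= k + u k -> exists2 i, k <= i < j & parent u i j.
Proof.
move=> kju; have ex_i : exists i, (k <= i < j) && (j <= i + u i) by exists k; lia.
have [|i /andP[kij ju] i_max] := ex_maxnP ex_i (m := j); first by lia.
exists i => //; apply/parentP; split=> // [|i' ii']; first by lia.
by rewrite ltnNge; apply/negP => ju'; have := i_max i'; lia.
Qed.

Lemma sum_parent_le1 a b j : \sum_(a <= i < b) parent u i j <= 1.
Proof.
rewrite -big_mkcond sum1_count /=.
have [/hasP[k _ kj]|] := boolP (has (parent u ^~ j) (index_iota a b)); last first.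
  by rewrite has_count -eqn0Ngt => /eqP ->.
apply: leq_trans (sub_count (a2 := pred1 k) _ _) _ => [i ij|].
  by apply/eqP; apply: parent_inj ij kj.
by rewrite count_uniq_mem ?iota_uniq ?leq_b1.
Qed.

Variable d : nat.
Hypotheses (d_gt0 : 0 < d) (u_periodic : periodic d u).

Lemma parent_addr k j : parent u (k + d) (j + d) = parent u k j.
Proof.
apply/parentP/parentP; rewrite u_periodic => -[kj ju outside]; split; try lia.
  by move=> i kij; have := outside (i + d); rewrite u_periodic; lia.
by move=> i kij; have := outside (i - d); rewrite -[u (i - d)]u_periodic subnK; lia.
Qed.

Lemma parent_le_period k j : parent u k j -> j <= k + d.
Proof.
move=> /parentP[kj ju outside]; rewrite leqNgt; apply/negP => kdj.
by have := outside (k + d); rewrite u_periodic; lia.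
Qed.

Lemma children_le k : children d u k <= d.
Proof.
apply: leq_trans (sum_le1_leq _ _ _) _ => [j|]; first exact: leq_b1.
by rewrite addnS subSS addKn.
Qed.

Lemma periodic_children : periodic d (children d u).
Proof.
move=> k; rewrite /children -addSn addnAC big_addn addnK.
by apply: eq_bigr => j _; rewrite parent_addr.
Qed.

Lemma childrenE k m : k + d < m -> children d u k = \sum_(0 <= j < m) parent u k j.
Proof.
move=> km; rewrite (@sum_nat_support k.+1 (k + d.+1)) => [//||j kj]; first by lia.
apply/eqP; rewrite eqb0; apply: contra kj => kj.
by have := parent_le_period kj; have /parentP[] := kj; lia.
Qed.

Lemma sum_children a b m : b + d <= m ->
  \sum_(a <= k < b) children d u k = \sum_(0 <= j < m) \sum_(a <= k < b) parent u k j.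
Proof.
move=> bm; rewrite exchange_big_nat /=; apply: eq_big_nat => k kb.
by apply: childrenE; lia.
Qed.

(* Summed over q periods, it counts children among the first (q + 1) d positions;
   take q = d + 1. *)
Lemma sum_children_period_le : \sum_(0 <= k < d) children d u k <= d.
Proof.
set total := \sum_(_ <= _ < _) _.
suff : d.+1 * total <= d.+1 * d + d by nia.
rewrite -(sum_nat_mul_period 0 _ periodic_children) add0n (sum_children _ (leqnn _)).
by rewrite -[leqRHS]subn0; apply: sum_le1_leq => j; apply: sum_parent_le1.
Qed.

Lemma leq_sum_children k s : s <= u k -> s <= \sum_(k <= i < k + s) children d u i.
Proof.
move=> su; rewrite (sum_children _ (leqnn _)).
rewrite (@sum_nat_split3 k.+1 (k + s).+1); last lia.
apply: leq_trans (leq_trans (leq_addl _ _) (leq_addr _ _)).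
rewrite -[leqLHS](addKn k) -subSS; apply: sum_gt0_geq => j kj.
have [|i ki ij] := @exists_parent k j; first by lia.
by rewrite (bigD1_seq i) ?mem_index_iota ?iota_uniq ?ij //=; lia.
Qed.

Lemma sum_children_nested n k : nested n u -> u k < n ->
  \sum_(k <= i < k + (u k).+1) children d u i <= u k.
Proof.
move=> nest uk; rewrite (sum_children _ (leqnn _)).
rewrite (@sum_nat_support k.+1 (k + u k).+1) => [||j kj]; last 1 first.
- rewrite big_nat big1 // => i ki; apply/eqP; rewrite eqb0.
  apply: contra kj => /parentP[ij ju _].
  by move: ki ij ju; have := nest k i uk; have [<-|] := eqVneq k i; lia.
- apply: leq_trans (sum_le1_leq _ _ (sum_parent_le1 _ _)) _.
  by rewrite subSS addKn.
- lia.
Qed.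

Lemma childrenK n : d <= n -> nested n u -> (forall k, u k <= n) ->
  descendants n d (children d u) =1 u.
Proof.
move=> d_le_n nest un k; apply: descendants_unique => // [s _ su|].
  exact: leq_sum_children.
have := un k; rewrite leq_eqVlt => /predU1P[uk|uk]; first by right.
left; split; last exact: sum_children_nested nest uk.
by rewrite ltnNge; apply/negP => du; have := nest k (k + d) uk; rewrite u_periodic; lia.
Qed.

End Children.

(** * Order patterns of words *)

Lemma ltn_count_ltn (s : seq nat) x y : x \in s ->
  (count (fun z => z < x) s < count (fun z => z < y) s) = (x < y).
Proof.
move=> xs; apply/idP/idP => [|xy].
  by apply: contraTT; rewrite -!leqNgt => yx; apply: sub_count => z /=; lia.
elim: s xs => [//|a s IHs]; rewrite inE => /predU1P[<-|xs] /=.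
  by rewrite ltnn xy ltnS; apply: sub_count => z /=; lia.
by have := IHs xs; case: (ltnP a x); case: (ltnP a y); lia.
Qed.

Lemma std_eqP (s t : seq nat) : size s = size t ->
  reflect (forall i j, i < size s -> j < size s ->
             (nth 0 s i < nth 0 s j) = (nth 0 t i < nth 0 t j))
          (std s == std t).
Proof.
move=> st; apply: (iffP eqP) => [std_st i j si sj|lt_st].
  have countE k : k < size s -> count (fun y => y < nth 0 s k) s
                              = count (fun y => y < nth 0 t k) t.
    move=> sk; have := congr1 (fun r => nth 0 r k) std_st.
    by rewrite !(nth_map 0) -?st.
  by rewrite -(@ltn_count_ltn s) ?mem_nth // !countE // ltn_count_ltn // mem_nth -?st.
apply: (@eq_from_nth _ 0); rewrite !size_map // => i si.
rewrite !(nth_map 0) -?st // -!sum1_count.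
rewrite [LHS](big_nth 0) [RHS](big_nth 0) !big_mkord -st.
by apply: eq_bigl => j; apply: lt_st.
Qed.

Lemma down_closed_count (p : pred nat) m b :
  (forall a b, 0 < a < b -> b <= m -> p b -> p a) -> 0 < b <= m ->
  p b = (b <= count p (iota 1 m)).
Proof.
elim: m b => [|m IHm] b p_down; first lia.
rewrite -[X in iota 1 X]addn1 iotaD count_cat /= addn0 add1n => bm.
have IH := IHm _ (fun a b ab bm => p_down a b ab (leqW bm)).
have [pm|npm] := boolP (p m.+1); last first.
  rewrite addn0; have [b_le_m|m_lt_b] := leqP b m; first by apply: IH; lia.
  have -> : b = m.+1 by lia.
  by rewrite (negPf npm) leqNgt ltnS (leq_trans (count_size _ _)) ?size_iota.
have all_p : all p (iota 1 m).
  by apply/allP => a; rewrite mem_iota => am; apply: p_down pm; lia.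
move: all_p; rewrite all_count size_iota => /eqP ->.
have [->|bm'] := eqVneq b m.+1; first by rewrite pm addn1 leqnn.
by rewrite (p_down b m.+1) //; lia.
Qed.

Section Words.
Variable m : nat.
Implicit Type s : {perm 'I_m}.

Lemma size_word s : size (word s) = m.
Proof. by rewrite size_map size_enum_ord. Qed.

Lemma nth_word s (i : 'I_m) : nth 0 (word s) i = s i.
Proof. by rewrite /word (nth_map i) ?size_enum_ord // nth_ord_enum. Qed.

Lemma perm_word s : perm_eq (word s) (iota 0 m).
Proof.
rewrite -val_enum_ord /word (map_comp val s) perm_map //.
apply: uniq_perm => [||i]; rewrite ?(map_inj_uniq perm_inj) ?enum_uniq //.
by rewrite -[LHS]/(i \in codom s) perm_onto mem_enum.
Qed.

Lemma count_word_ltn s v : v <= m -> count (fun y => y < v) (word s) = v.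
Proof.
move=> vm; rewrite (seq.permP (perm_word s)) -size_filter.
by have := filter_iota_ltn 0 vm; rewrite add0n => ->; rewrite size_iota.
Qed.

Lemma std_word s : std (word s) = word s.
Proof.
rewrite /std -[RHS]map_id; apply/eq_in_map => x.
rewrite (perm_mem (perm_word s)) mem_iota => xm; apply: count_word_ltn; lia.
Qed.

Lemma word_inj : injective (@word m).
Proof.
by move=> s t st; apply/permP => i; apply: val_inj; rewrite /= -!nth_word st.
Qed.

End Words.

Definition order_perm (m : nat) (R : rel 'I_m.+1) : {perm 'I_m.+1} :=
  insubd (1%g : {perm 'I_m.+1}) [ffun x => inord #|[set y | R y x]|].

Lemma order_permE m (R : rel 'I_m.+1) :
  irreflexive R -> transitive R -> (forall x y, x != y -> R x y || R y x) ->
  forall x y, (order_perm R x < order_perm R y) = R x y.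
Proof.
move=> R_irr R_trans R_total; pose rank x := #|[set y | R y x]|.
have rank_le x : rank x < m.+1.
  rewrite -[ltnRHS]card_ord -cardsT; apply: proper_card.
  by rewrite properT; apply/eqP => /setP/(_ x); rewrite !inE R_irr.
have rank_mono x y : R x y -> rank x < rank y.
  move=> xy; apply: proper_card; apply/properP; split.
    by apply/subsetP => z; rewrite !inE => /R_trans; apply.
  by exists x; rewrite !inE ?R_irr.
have rankE x y : (rank x < rank y) = R x y.
  apply/idP/idP => [xy|]; last exact: rank_mono.
  have [e|/R_total/orP[//|/rank_mono]] := eqVneq x y; first by rewrite e ltnn in xy.
  by rewrite ltnNge ltnW.
have rank_inj : injectiveb [ffun x => inord (rank x) : 'I_m.+1].
  apply/injectiveP => x y; rewrite !ffunE => /(congr1 val); rewrite /= !inordK // => e.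
  by apply/eqP/negP => /negP/R_total; rewrite -!rankE e ltnn.
move=> x y; rewrite /order_perm -!pvalE !insubdK // !ffunE.
by rewrite !inordK; [apply: rankE | apply: rank_le..].
Qed.

(** * Windows of 312-avoiding walks *)

Section Windows.
Variable n : nat.
Implicit Type s t : {perm 'I_n.+1}.

(* Positions are counted from the right end of the word, so that [rentry (s k) a]
   is the entry of a reversed walk [s] at the absolute position [k + a]. *)
Definition rentry s (a : nat) : nat := nth 0 (word s) (n - a).

Lemma rentry_inord s a : rentry s a = s (inord (n - a)).
Proof. by rewrite -nth_word inordK // ltnS leq_subr. Qed.

Lemma rentry_ord s (i : 'I_n.+1) : rentry s (n - i) = s i.
Proof. by rewrite /rentry subKn ?nth_word // -ltnS. Qed.

Lemma rentry_inj s a b : a <= n -> b <= n -> (rentry s a == rentry s b) = (a == b).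
Proof.
move=> an bn; rewrite nth_uniq ?size_word ?(perm_uniq (perm_word s)) ?iota_uniq; lia.
Qed.

Lemma eq_from_rentry s t :
  (forall a b, a <= n -> b <= n ->
     (rentry s a < rentry s b) = (rentry t a < rentry t b)) ->
  s = t.
Proof.
move=> st; apply: word_inj; rewrite -std_word -[RHS]std_word; apply/eqP/std_eqP.
  by rewrite !size_word.
rewrite size_word => i j ni nj; have := st (n - i) (n - j); rewrite /rentry !subKn; lia.
Qed.

Lemma avoids312P s :
  reflect (forall a b c, a < b < c -> c <= n ->
             rentry s a < rentry s c -> rentry s a < rentry s b)
          (avoids312 s).
Proof.
apply: (iffP idP) => [/existsPn s_avoids a b c abc cn ac|s_avoids].
  have := s_avoids (inord (n - c)).
  move=> /existsPn/(_ (inord (n - b)))/existsPn/(_ (inord (n - a))).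
  rewrite -!rentry_inord ac !inordK; try lia.
  by have := @rentry_inj s a b; lia.
apply/existsPn => i; apply/existsPn => j; apply/existsPn => k.
apply/negP => /and4P[ij jk sjk ski].
by have := s_avoids (n - k) (n - j) (n - i); rewrite !rentry_ord; have := ltn_ord k; lia.
Qed.

Lemma overlapP s t :
  reflect (forall a b, a < n -> b < n ->
             (rentry s a < rentry s b) = (rentry t a.+1 < rentry t b.+1))
          (ehead s == etail t).
Proof.
have size_s : size (drop 1 (word s)) = n by rewrite size_drop size_word subn1.
have size_t : size (take n (word t)) = n by rewrite size_take size_word ltnSn.
have nth_s a : a < n -> nth 0 (drop 1 (word s)) (n - a.+1) = rentry s a.
  by move=> an; rewrite nth_drop /rentry; congr nth; lia.
have nth_t a : a < n -> nth 0 (take n (word t)) (n - a.+1) = rentry t a.+1.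
  by move=> an; rewrite nth_take //; lia.
apply: (iffP (std_eqP (etrans size_s (esym size_t)))); rewrite size_s => st a b an bn.
  by rewrite -!nth_s // -!nth_t //; apply: st; lia.
have rev_lt i : i < n -> n - i.+1 < n by lia.
have revK i : i < n -> i = n - (n - i.+1).+1 by lia.
by rewrite (revK a) // (revK b) // !nth_s ?rev_lt // !nth_t ?rev_lt // st ?rev_lt.
Qed.

(* [n - rentry s 0] entries exceed the last one, and avoiding 312 makes them
   contiguous. *)
Lemma avoids312_last s b : avoids312 s -> 0 < b <= n ->
  (rentry s 0 < rentry s b) = (b <= n - rentry s 0).
Proof.
move=> /avoids312P s_avoids bn.
rewrite (@down_closed_count (fun b => rentry s 0 < rentry s b) n) //; last first.
  by move=> a c ac cn; apply: s_avoids.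
congr (_ <= _); have s0_le : rentry s 0 < n.+1 by rewrite rentry_inord ltn_ord.
have wordE : word s = rev [seq rentry s a | a <- iota 0 n.+1].
  apply: (@eq_from_nth _ 0) => [|i]; rewrite size_word.
    by rewrite size_rev size_map size_iota.
  move=> ni; rewrite nth_rev size_map size_iota //.
  rewrite (nth_map 0) ?size_iota ?nth_iota; try lia.
  by rewrite /rentry; congr nth; lia.
have above_word : count (predC (fun y => y < (rentry s 0).+1)) (word s)
                = count (fun b => rentry s 0 < rentry s b) (iota 1 n).
  rewrite [X in count _ X]wordE count_rev /= ltnSn add0n count_map.
  by apply: eq_count => b' /=; rewrite -leqNgt.
have := count_predC (fun y => y < (rentry s 0).+1) (word s).
by rewrite count_word_ltn // above_word size_word; lia.
Qed.

End Windows.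

(* [below u i j] is the order that the descendant numbers [u] prescribe between
   the positions [i] and [j] of a reversed walk: the positions after [i] that lie
   above it are its descendants [i + 1, ..., i + u i]. *)
Definition below (u : nat -> nat) (i j : nat) : bool :=
  if i < j then j <= i + u i else (j < i) && (j + u j < i).

Lemma below_trans n u k i j l : nested n u ->
  k <= i <= k + n -> k <= j <= k + n -> k <= l <= k + n ->
  below u i j -> below u j l -> below u i l.
Proof.
move=> nest ki kj kl; rewrite /below.
have := nest i j; have := nest l i; have := nest j l.
have : i = l -> u i = u l by move=> ->.
by case: (ltngtP i j) => ij; case: (ltngtP j l) => jl; case: (ltngtP i l) => il //=; lia.
Qed.

Definition window (n : nat) (u : nat -> nat) (k : nat) : {perm 'I_n.+1} :=
  order_perm (fun x y : 'I_n.+1 => below u (k + (n - x)) (k + (n - y))).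

Lemma eq_window n u k u' k' :
  (forall i, u (k + i) = u' (k' + i)) -> window n u k = window n u' k'.
Proof.
move=> uu'; congr (insubd _ _); apply/ffunP => x; rewrite !ffunE; congr inord.
by apply: eq_card => y; rewrite !inE /below !uu' !ltn_add2l -!addnA !leq_add2l !ltn_add2l.
Qed.

Section NestedWindows.
Variables (n : nat) (u : nat -> nat).
Hypothesis u_nested : nested n u.

Lemma rentry_window k a b : a <= n -> b <= n ->
  (rentry (window n u k) a < rentry (window n u k) b) = below u (k + a) (k + b).
Proof.
move=> an bn; rewrite !rentry_inord order_permE ?inordK ?subKn //; try lia.
- by move=> x; rewrite /below ltnn.
- by move=> x y z; apply: (@below_trans n _ k) => //; lia.
move=> x y xy; have {}xy : x <> y :> nat by move/val_inj/eqP; apply/negP.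
by rewrite /below; case: ltngtP => /=; have := ltn_ord x; have := ltn_ord y; lia.
Qed.

Lemma avoids312_window k : avoids312 (window n u k).
Proof.
apply/avoids312P => a b c abc cn; have [ab ac] : a < b /\ a < c by lia.
by rewrite !rentry_window /below ?ltn_add2l ?ab ?ac; lia.
Qed.

Lemma overlap_window k : ehead (window n u k.+1) == etail (window n u k).
Proof. by apply/overlapP => a b an bn; rewrite !rentry_window ?addSnnS // ltnW. Qed.

Lemma rentry_window0 k : u k <= n -> n - rentry (window n u k) 0 = u k.
Proof.
move=> uk; set s := window n u k.
have last_block b : 0 < b <= n -> (b <= u k) = (b <= n - rentry s 0).
  move=> bn; rewrite -avoids312_last ?avoids312_window // rentry_window //; last lia.
  by rewrite /below ltn_add2l addn0 leq_add2l; case/andP: bn => ->.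
by have := last_block (u k); have := last_block (n - rentry s 0); lia.
Qed.

End NestedWindows.

Definition walk_step (n : nat) : rel {perm 'I_n.+1} :=
  fun s t => [&& avoids312 s, avoids312 t & ehead s == etail t].

Section ReversedWalks.
Variables (n : nat) (s : nat -> {perm 'I_n.+1}).
Hypothesis s_walk : forall k, walk_step (s k.+1) (s k).

Definition walk_descendants (k : nat) : nat := n - rentry (s k) 0.

Lemma rentry_walk_lt k a b : a < b <= n ->
  (rentry (s k) a < rentry (s k) b) = (k + b <= k + a + walk_descendants (k + a)).
Proof.
elim: a k b => [|a IHa] k b abn; have /and3P[_ s_av s_overlap] := s_walk k.
  by rewrite avoids312_last ?addn0 ?leq_add2l //; lia.
case: b abn => [//|b] abn.
by move/overlapP: s_overlap => <-; rewrite ?IHa ?addSnnS //; lia.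
Qed.

Lemma rentry_walk k a b : a <= n -> b <= n ->
  (rentry (s k) a < rentry (s k) b) = below walk_descendants (k + a) (k + b).
Proof.
move=> an bn; have := @rentry_inj _ (s k) a b an bn; rewrite /below !ltn_add2l.
case: (ltngtP a b) => [ab|ba|-> _]; last by rewrite ltnn.
  by rewrite rentry_walk_lt // ab.
by have := @rentry_walk_lt k b a; lia.
Qed.

Lemma nested_walk_descendants : nested n walk_descendants.
Proof.
move=> k j uk kj; rewrite leqNgt; apply/negP => k_lt_j.
set u := walk_descendants in uk kj k_lt_j.
have := @rentry_walk_lt k (j - k) (u k).+1; have := @rentry_walk_lt k 0 (j - k).
have := @rentry_walk_lt k 0 (u k).+1; rewrite addn0 subnKC -/u; lia.
Qed.

Lemma window_walk_descendants : window n walk_descendants =1 s.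
Proof.
move=> k; apply: eq_from_rentry => a b an bn.
by rewrite (rentry_window nested_walk_descendants) ?rentry_walk.
Qed.

End ReversedWalks.

(** * Counting closed walks *)

Lemma closed_walkE n d (w : d.-tuple {perm 'I_n.+1}) : 0 < d ->
  closed_walk w = path.cycle (@walk_step n) w.
Proof.
move=> d_gt0; have size_gt0 : 0 < size w by rewrite size_tuple.
apply/idP/(cycle_nthP 1%g _ size_gt0) => [/andP[/allP w_avoids]|w_step].
  move=> /forallP w_overlap k.
  rewrite /walk_step !w_avoids ?mem_cyclic_nth //=.
  have := w_overlap (Ordinal (ltn_pmod k d_gt0)); rewrite (tnth_nth 1%g) /=.
  by rewrite /cyclic_nth size_tuple -[(k %% d).+1]addn1 modnDml addn1.
apply/andP; split.
  apply/allP => _ /(nthP 1%g)[i iw <-].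
  by have /and3P[] := w_step i; rewrite cyclic_nth_small.
apply/forallP => i; have /and3P[_ _] := w_step i; rewrite (tnth_nth 1%g).
by rewrite cyclic_nth_small ?size_tuple // /cyclic_nth size_tuple.
Qed.

Section CodeWalk.
Variables n d : nat.
Hypotheses (d_gt0 : 0 < d) (d_le_n : d <= n).
Implicit Types (t : d.-tuple 'I_d.+1) (w : d.-tuple {perm 'I_n.+1}).

Definition code t (k : nat) : nat := cyclic_nth ord0 t k.

Definition code_walk t : d.-tuple {perm 'I_n.+1} :=
  [tuple window n (descendants n d (code t)) k | k < d].

Lemma periodic_code t : periodic d (code t).
Proof. by move=> k; rewrite /code periodic_cyclic_nth_tuple. Qed.

Lemma sum_code t : \sum_(0 <= i < d) code t i = \sum_(i <- t) i.
Proof.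
rewrite big_mkord big_tuple; apply: eq_bigr => i _.
by rewrite /code cyclic_nth_small ?size_tuple // (tnth_nth ord0).
Qed.

Lemma cyclic_nth_code_walk t :
  cyclic_nth 1%g (code_walk t) =1 window n (descendants n d (code t)).
Proof.
apply: cyclic_nth_mktuple => // k; apply: eq_window => i.
by rewrite addnAC periodic_descendants //; apply: periodic_code.
Qed.

Lemma code_walk_cycle t : code_walk t \in cycles (fun s s' => walk_step s' s) d.
Proof.
rewrite inE; apply/(cycle_nthP 1%g) => [|k]; first by rewrite size_tuple.
have nest := @nested_descendants n d d_le_n (code t).
by rewrite !cyclic_nth_code_walk /walk_step !avoids312_window // overlap_window.
Qed.

Lemma code_walk_inj :
  {in [set t : d.-tuple 'I_d.+1 | \sum_(i <- t) i <= d] &, injective code_walk}.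
Proof.
move=> t t'; rewrite !inE -!sum_code => t_sum t'_sum eq_walk.
apply: (@cyclic_nth_tuple_inj _ ord0) => k; apply: val_inj.
have t_periodic := periodic_code t; have t'_periodic := periodic_code t'.
apply: (descendants_inj d_le_n d_gt0 t_periodic t'_periodic t_sum t'_sum) => {}k.
have nest x := @nested_descendants n d d_le_n (code x).
rewrite -(rentry_window0 (nest t)) ?descendants_le //.
rewrite -(rentry_window0 (nest t')) ?descendants_le //.
by rewrite -!cyclic_nth_code_walk eq_walk.
Qed.

Lemma code_walk_onto w : w \in cycles (fun s s' => walk_step s' s) d ->
  exists2 t, t \in [set t : d.-tuple 'I_d.+1 | \sum_(i <- t) i <= d] & w = code_walk t.
Proof.
rewrite inE => /(cycle_nthP 1%g); rewrite size_tuple => /(_ d_gt0) w_walk.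
pose u := walk_descendants (cyclic_nth 1%g w).
have u_periodic : periodic d u.
  by move=> k; rewrite /u /walk_descendants periodic_cyclic_nth_tuple.
pose t : d.-tuple 'I_d.+1 := [tuple inord (children d u k) | k < d].
have codeE : code t =1 children d u.
  move=> k; rewrite /code.
  rewrite (@cyclic_nth_mktuple _ ord0 (fun k => inord (children d u k))) //.
    by rewrite inordK // ltnS children_le.
  by move=> j; rewrite periodic_children.
exists t.
  rewrite inE -sum_code; under eq_bigr do rewrite codeE.
  exact: sum_children_period_le.
apply: (@cyclic_nth_tuple_inj _ 1%g) => k; rewrite cyclic_nth_code_walk.
rewrite -(window_walk_descendants w_walk) -/u; apply: eq_window => i.
rewrite (@eq_descendants _ _ _ (children d u) _ (k + i)) => [|j]; last exact: codeE.
by rewrite childrenK // => [|j]; [apply: nested_walk_descendants | apply: leq_subr].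
Qed.

Lemma card_cycles_walk_step : #|cycles (@walk_step n) d| = 'C(2 * d, d).
Proof.
rewrite -card_cycles_rev mul2n -addnn -card_partial_ord_partitions.
rewrite -(card_in_imset code_walk_inj); apply: eq_card => w.
apply/idP/imsetP => [/code_walk_onto //|[t _ ->]].
exact: code_walk_cycle.
Qed.

End CodeWalk.

Local Open Scope ring_scope.

Theorem theorem5p2 (n d : nat) :
  (1 <= n)%N -> (0 < d)%N -> (d <= n)%N ->
  (#|d_cycles n d|%:R : rat) =
    (d%:R)^-1 * \sum_(e < d.+1 | (e %| d)%N) (moebius (d %/ e))%:~R * ('C(2 * e, e))%:R.
Proof.
move=> _ d_gt0 d_le_n.
have -> : d_cycles n d = [set rot_class w | w in primitive_cycles (@walk_step n) d].
  apply/setP => C; apply/imsetP/imsetP => -[w wC ->]; exists w => //;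
    by move: wC; rewrite !inE closed_walkE.
rewrite (card_primitive_rot_classes_moebius 1%g) //.
rewrite (big_divisors_ord _ (fun e => (moebius (d %/ e))%:~R * 'C(2 * e, e)%:R)) ?d_gt0 //=.
congr (_ * _); apply: eq_big_seq => e; rewrite -dvdn_divisors // => e_dvd_d.
by rewrite card_cycles_walk_step ?(dvdn_gt0 d_gt0) // (leq_trans (dvdn_leq d_gt0 e_dvd_d)).
Qed.
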